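(* For every squarefree $d>1$ there is a unique $s_*(d)\in(1,\infty)$ with $N(s_*(d))=0$, where $N(s)=\zeta(s)^2-d\,L(s,\chi_d)^2$ for real $s>1$. Moreover $N(s)>0$ for $1<s<s_*(d)$ and $N(s)<0$ for $s>s_*(d)$.
   Context: $\chi_d$ is the Kronecker symbol of the fundamental discriminant of $\mathbb{Q}(\sqrt d)$. *)

(* Defs.v *)
From HB Require Import structures.
From mathcomp Require Import all_boot all_order all_algebra.
From mathcomp Require Import all_classical all_reals all_analysis.
Set Implicit Arguments.
Unset Strict Implicit.
Unset Printing Implicit Defensive.
Import Order.TTheory GRing.Theory Num.Theory.
Import numFieldNormedType.Exports.
Local Open Scope ring_scope.

Definition squarefree (d : nat) : Prop :=
  forall m : nat, (m ^ 2 %| d)%N -> m = 1%N.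

(* The discriminant of the quadratic field generated by the square root of d;
   meaningful for d > 1 squarefree. *)
Definition fund_disc (d : nat) : nat :=
  if (d %% 4 == 1)%N then d else (4 * d)%N.

(* For odd prime p this is the Legendre symbol (a/p); the value at p = 2 is
   Kronecker's. *)
Definition kronecker_prime (a p : nat) : int :=
  if p == 2%N then
    if ~~ odd a then 0
    else if (a %% 8 == 1)%N || (a %% 8 == 7)%N then 1 else -1
  else if (p %| a)%N then 0
  else if [exists x : 'I_p, ((x : nat) ^ 2 == a %[mod p])%N] then 1 else -1.

(* (a/n), restricted to nonnegative a and n. *)
Definition kronecker (a n : nat) : int :=
  if n == 0%N then (a == 1%N)%:R
  else \prod_(p <- primes n) kronecker_prime a p ^+ logn p n.

Definition chi (d n : nat) : int := kronecker (fund_disc d) n.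

(* Meaningful for s > 1 only: limn is total. The library's riemannR s k is
   1 / (k + 1) ^ s, so index k carries the term n = k + 1. *)
Definition zeta (R : realType) (s : R) : R := limn (series (riemannR s)).

Definition Lchi (R : realType) (d : nat) (s : R) : R :=
  limn (series (fun k => (chi d k.+1)%:~R * riemannR s k)).

Definition Nfun (R : realType) (d : nat) (s : R) : R :=
  zeta s ^+ 2 - d%:R * Lchi d s ^+ 2.

(* Main.v *)
Require Import Defs.
From mathcomp Require Import all_boot all_order all_algebra.
From mathcomp Require Import all_classical all_reals all_analysis.
From mathcomp Require Import zify ring lra.
Import Order.TTheory GRing.Theory Num.Theory.
Import numFieldNormedType.Exports.
Local Open Scope ring_scope.
Set Implicit Arguments.
Unset Strict Implicit.
Unset Printing Implicit Defensive.

(** For real s > 1 both zeta(s) and L(s, chi) are limits of their Euler products.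
    Each local factor (1 - chi(p) p^-s) / (1 - p^-s) of zeta / L is nonincreasing
    in s, and it is strictly decreasing at a prime dividing d, where chi
    vanishes. So zeta / L is strictly decreasing, the sign of N changes at most
    once, and N(5) < 0 by the trivial bounds on zeta(5) and L(5, chi).

    It remains to find s with N(s) > 0, and since zeta is unbounded near 1 it is
    enough that L be bounded on (1, oo). Neither reciprocity nor the periodicity
    of chi is needed. Let rho(n) be the number of square roots of d modulo n.
    Thue's lemma attaches to each such root t a small nonzero vector (x, y) with
    x = t y mod n and n | x^2 - d y^2 <> 0, and at most d^2 pairs (n, t) share a
    vector; hence sum_(n <= N) rho(n) <= 9 d^2 N. By Abel summation the Dirichlet
    series of rho is at most 9 d^2 zeta, while comparing Euler factors bounds
    zeta L by a constant multiple of it. *)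

(** * Euler products *)

(** The positive integers surviving a sieve by the primes below [P]. *)
Definition rough (P n : nat) := all (leq P) (primes n).

Lemma rough0 n : rough 0 n.
Proof. exact/allP. Qed.

Lemma roughS P n : (0 < n)%N ->
  rough P.+1 n = rough P n && ~~ (prime P && (P %| n)%N).
Proof.
move=> n_gt0; apply/allP/andP => [h|[/allP h1 h2] p pn].
  split; first by apply/allP => p /h /ltnW.
  apply/negP => /andP[pP Pn]; have := h P.
  by rewrite mem_primes pP n_gt0 Pn ltnn => /(_ isT).
rewrite ltn_neqAle h1 // andbT; apply: contra h2 => /eqP ->.
by move: pn; rewrite mem_primes n_gt0.
Qed.

Lemma roughM P p n : prime p -> (P <= p)%N -> (0 < n)%N ->
  rough P (p * n) = rough P n.
Proof.
move=> pp Pp n0; apply/allP/allP => h q; first last.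
  rewrite (primesM _ (prime_gt0 pp) n0) => /orP[|/h //].
  by rewrite primes_prime // inE => /eqP ->.
by move=> qn; apply: h; rewrite (primesM _ (prime_gt0 pp) n0) qn orbT.
Qed.

Lemma rough_lt P n : (1 < n < P)%N -> rough P n = false.
Proof.
case/andP=> n1 nP; apply/negP => /allP /(_ (pdiv n)).
rewrite mem_primes pdiv_prime // (ltnW n1) pdiv_dvd => /(_ isT) h.
have := leq_trans h (pdiv_leq (ltnW n1)); lia.
Qed.

Lemma cvg_subseq (R : realType) (u : nat -> R) (f : nat -> nat) (l : R) :
  (f x @[x --> \oo] --> \oo)%classic -> (u x @[x --> \oo] --> l)%classic ->
  ((u \o f) x @[x --> \oo] --> l)%classic.
Proof. by move=> hf hu; apply: cvg_comp hf hu. Qed.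

(** In each block of [p] consecutive indices only the last [k] has [p] dividing [k.+1]. *)
Lemma sum_multiples (V : nmodType) (f : nat -> V) p K : (0 < p)%N ->
  \sum_(0 <= k < K * p) (if (p %| k.+1)%N then f k.+1 else 0) =
  \sum_(0 <= m < K) f (p * m.+1)%N.
Proof.
move=> p_gt0; rewrite big_nat_mul; apply: eq_bigr => i _.
case: p p_gt0 => // p _.
rewrite [(i.+1 * _)%N]mulSnr addnS big_nat_recr ?leq_addr //=.
rewrite big_nat big1 ?add0r => [|j /andP[j1 j2]]; last first.
  case: ifP => // /dvdnP[q jq].
  have : (i * p.+1 < q * p.+1)%N by rewrite -jq ltnS.
  have : (q * p.+1 < i.+1 * p.+1)%N by rewrite -jq mulSnr addnS ltnS.
  by rewrite !ltn_pmul2r // ltnS => qi /(leq_ltn_trans qi); rewrite ltnn.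
by rewrite -addnS -mulSnr dvdn_mull // mulnC.
Qed.

Lemma dominated_series_cvg (R : realType) (u v : nat -> R) :
  (forall k, `|u k| <= v k) -> cvgn (series v) -> cvgn (series u).
Proof.
move=> uv cv; apply: normed_cvg; apply: series_le_cvg cv => //= k.
exact: le_trans (normr_ge0 _) (uv k).
Qed.

Definition rough_sum (R : realType) (c : nat -> R) P : R :=
  limn (series (fun k => if rough P k.+1 then c k.+1 else 0)).

(** One sieving step: the [P]-rough multiples of a prime [P] are the [P * m] with [m] itself
    [P]-rough, so they contribute [c P] times the whole rough sum. *)
Lemma rough_sumS (R : realType) (c a : nat -> R) P :
  (forall p m, prime p -> (0 < m)%N -> c (p * m)%N = c p * c m) ->
  (forall n, `|c n| <= a n) -> cvgn (series (fun k => a k.+1)) ->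
  rough_sum c P.+1 = (if prime P then 1 - c P else 1) * rough_sum c P.
Proof.
move=> cM ca acvg; pose cr Q n := if rough Q n then c n else 0.
have cra Q n : `|cr Q n| <= a n.
  rewrite /cr; case: ifP => // _; rewrite normr0; exact: le_trans (ca n).
have ccvg Q : cvgn (series (fun k => cr Q k.+1)).
  exact: dominated_series_cvg acvg.
have [pP|nP] := boolP (prime P); last first.
  rewrite mul1r /rough_sum; congr (limn (series _)); apply/funext => k.
  by rewrite roughS // (negbTE nP) andbT.
have P0 := prime_gt0 pP.
rewrite mulrBl mul1r.
(* At length [K * P] the multiples of [P] correspond exactly to the first [K] terms, so the identity
   between partial sums has no remainder. *)
have e K : series (fun k => cr P.+1 k.+1) (K * P)%N =
    series (fun k => cr P k.+1) (K * P)%N - c P * series (fun k => cr P k.+1) K.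
  have <- : \sum_(0 <= k < K * P) (if (P %| k.+1)%N then cr P k.+1 else 0) =
      c P * series (fun k => cr P k.+1) K.
    rewrite sum_multiples // /series /= mulr_sumr; apply: eq_bigr => m _.
    by rewrite /cr roughM // cM //; case: ifP; rewrite ?mulr0.
  rewrite /series /= -sumrB; apply: eq_bigr => k _.
  rewrite /cr roughS // pP /=.
  by case: (rough P k.+1); case: (P %| k.+1)%N; rewrite /= ?subrr ?subr0.
have lim1 : (series (fun k => cr P.+1 k.+1) (K * P)%N @[K --> \oo] -->
    rough_sum c P.+1)%classic.
  apply: cvg_subseq (ccvg _); exact: cvg_mulnr.
have lim2 : (series (fun k => cr P.+1 k.+1) (K * P)%N @[K --> \oo] -->
    rough_sum c P - c P * rough_sum c P)%classic.
  under eq_fun do rewrite e.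
  apply: cvgB; last by apply: cvgMr; exact: ccvg.
  apply: cvg_subseq (ccvg _); exact: cvg_mulnr.
exact: cvg_unique lim1 lim2.
Qed.

Lemma rough_sumE (R : realType) (c a : nat -> R) P :
  (forall p m, prime p -> (0 < m)%N -> c (p * m)%N = c p * c m) ->
  (forall n, `|c n| <= a n) -> cvgn (series (fun k => a k.+1)) ->
  rough_sum c P =
    \prod_(0 <= p < P | prime p) (1 - c p) * limn (series (fun k => c k.+1)).
Proof.
move=> cM ca acvg; elim: P => [|P IH].
  rewrite big_geq // mul1r /rough_sum; congr (limn (series _)).
  by apply/funext => k; rewrite rough0.
rewrite (rough_sumS _ cM ca acvg) IH mulrA big_mkcond [in RHS]big_mkcond /=.
by rewrite big_nat_recr //= [X in X * _]mulrC.
Qed.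

Lemma dominated_series_tail (R : realType) (u v : nat -> R) N :
  (forall k, `|u k| <= v k) -> cvgn (series v) ->
  `|limn (series u) - series u N| <= limn (series v) - series v N.
Proof.
move=> uv cv; have cu : cvgn (series u) by exact: dominated_series_cvg cv.
have v_ge0 k : 0 <= v k by exact: le_trans (uv k).
have h : (`|series u M - series u N| @[M --> \oo] -->
    `|limn (series u) - series u N|)%classic.
  by apply: cvg_norm; apply: cvgB; [exact: cu|exact: cvg_cst].
rewrite -(cvg_lim _ h) //; apply: limr_le; first exact: cvgP h.
exists N => // M /= NM; apply: le_trans (_ : series v M - series v N <= _).
  rewrite !sub_series_geq //; apply: le_trans (ler_norm_sum _ _ _) _.
  exact: ler_sum.
rewrite lerD2r; apply: nondecreasing_cvgn_le => //.
by apply: nondecreasing_series.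
Qed.

(** A [P]-rough n > 1 is at least [P], so everything except the term n = 1 lies in a tail of the
    dominating series. *)
Lemma rough_sum_cvg1 (R : realType) (c a : nat -> R) : c 1%N = 1 ->
  (forall n, `|c n| <= a n) -> cvgn (series (fun k => a k.+1)) ->
  (rough_sum c P @[P --> \oo] --> (1 : R))%classic.
Proof.
move=> c1 ca acvg.
have a_ge0 n : 0 <= a n by exact: le_trans (ca n).
pose A := series (fun k => a k.+1).
have tail P : `|rough_sum c P.+2 - 1| <= limn A - A P.+1.
  pose u k := if rough P.+2 k.+1 then c k.+1 else 0.
  have -> : 1 = series u P.+1.
    rewrite /series /= big_ltn // /u {1}/rough /= c1 big_nat big1 ?addr0 //.
    by move=> k /andP[k1 kP]; rewrite rough_lt // !ltnS k1.
  apply: dominated_series_tail acvg => k.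
  by rewrite /u; case: ifP => // _; rewrite normr0.
apply/cvgrPdist_le => e e0; have /cvgrPdist_le /(_ e e0) [N _ hN] := acvg.
exists N.+2 => // -[|[|P]] //= NP; rewrite distrC.
apply: le_trans (tail P) _; apply: le_trans (ler_norm _) _.
by apply: hN => /=; lia.
Qed.

(** Multiplying the series by the inverse local factors, rather than equating it with an infinite
    product, avoids all division. *)
Lemma euler_product (R : realType) (c a : nat -> R) : c 1%N = 1 ->
  (forall p m, prime p -> (0 < m)%N -> c (p * m)%N = c p * c m) ->
  (forall n, `|c n| <= a n) -> cvgn (series (fun k => a k.+1)) ->
  (\prod_(0 <= p < P | prime p) (1 - c p) * limn (series (fun k => c k.+1))
     @[P --> \oo] --> (1 : R))%classic.
Proof.
move=> c1 cM ca acvg.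
under eq_fun do rewrite -(rough_sumE _ cM ca acvg).
exact: rough_sum_cvg1.
Qed.

(** * The powers n^-s and convergence of zeta *)

Definition npow (R : realType) (s : R) (n : nat) : R := (n%:R `^ s)^-1.

Lemma npow1 (R : realType) (s : R) : npow s 1 = 1.
Proof. by rewrite /npow powR1 invr1. Qed.

Lemma npowM (R : realType) (s : R) m n : npow s (m * n) = npow s m * npow s n.
Proof. by rewrite /npow natrM powRM // invfM. Qed.

Lemma npow_ge0 (R : realType) (s : R) n : 0 <= npow s n.
Proof. by rewrite invr_ge0 powR_ge0. Qed.

Lemma npow_gt0 (R : realType) (s : R) n : (0 < n)%N -> 0 < npow s n.
Proof. by move=> n0; rewrite invr_gt0 powR_gt0 // ltr0n. Qed.

Lemma npow_le (R : realType) (s : R) m n : 0 <= s -> (0 < m <= n)%N ->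
  npow s n <= npow s m.
Proof.
move=> s0 /andP[m0 mn]; rewrite lef_pV2 ?posrE ?powR_gt0 ?ltr0n //; last by lia.
by apply: ge0_ler_powR; rewrite // ?nnegrE ?ler_nat.
Qed.

Lemma npow_lt (R : realType) (s t : R) n : s < t -> (1 < n)%N ->
  npow t n < npow s n.
Proof.
move=> st n1; have n0 : (0 < n)%N by lia.
rewrite ltf_pV2 ?posrE ?powR_gt0 ?ltr0n // /powR pnatr_eq0 gtn_eqF //.
by rewrite ltr_expR ltr_pM2r // ln_gt0 // ltr1n.
Qed.

Lemma npow_le_inv (R : realType) (s : R) n : 1 <= s -> npow s n <= n%:R^-1.
Proof.
case: n => [|n] s1; first by rewrite /npow powR0 ?invr0 //; lra.
rewrite lef_pV2 ?posrE ?powR_gt0 ?ltr0n //.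
by apply: le1r_powR; rewrite // ler1n.
Qed.

Lemma npow2_lt (R : realType) (s : R) : 1 < s -> 2 * npow s 2 < 1.
Proof.
move=> /npow_lt /(_ (isT : 1 < 2)%N); rewrite {2}/npow powRr1 //; lra.
Qed.

(** Pairing n = 2m with 2m + 1 gives S(2N + 1) <= 1 + 2 * 2^-s * S(N), and S(N) <= S(2N + 1) closes
    the inequality. The explicit bound also serves for the estimate at s = 5. *)
Lemma npow_series_le (R : realType) (s : R) N : 1 < s ->
  series (fun k => npow s k.+1) N <= (1 - 2 * npow s 2)^-1.
Proof.
move=> s1; set S := series _.
have Smono : {homo S : n m / (n <= m)%N >-> n <= m}.
  by apply: nondecreasing_series => k _ _; exact: npow_ge0.
have hS n : S n.+1 = S n + npow s n.+1 := seriesSr _ n.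
have q1 := npow2_lt s1.
have : S N.*2.+1 <= 1 + 2 * npow s 2 * S N.
  elim: N => [|N IH].
    by rewrite /S seriesSr /series /= !big_geq // add0r mulr0 addr0 npow1.
  rewrite doubleS (hS N.*2.+2) (hS N.*2.+1) (hS N).
  have -> : N.*2.+2 = (2 * N.+1)%N by lia.
  have : npow s (2 * N.+1).+1 <= npow s (2 * N.+1) by apply: npow_le; [lra|lia].
  rewrite npowM; lra.
have : S N <= S N.*2.+1 by apply: Smono; lia.
move=> h1 h2; rewrite -[_^-1]mul1r ler_pdivlMr; lra.
Qed.

Lemma npow_series_cvg (R : realType) (s : R) : 1 < s ->
  cvgn (series (fun k => npow s k.+1)).
Proof.
move=> s1; apply: nondecreasing_is_cvgn.
  by apply: nondecreasing_series => k _ _; exact: npow_ge0.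
by exists (1 - 2 * npow s 2)^-1 => _ [N _ <-]; exact: npow_series_le.
Qed.

(** * Dirichlet series with bounded coefficients *)

Lemma npow_continuous (R : realType) n : continuous (fun s : R => npow s n.+1).
Proof.
move=> s.
rewrite (_ : (fun s : R => npow s n.+1) = fun s => expR (- (s * ln n.+1%:R))).
  apply: continuous_comp; last exact: continuous_expR.
  by apply: cvgN; apply: cvgM; [exact: cvg_id|exact: cvg_cst].
by apply/funext => t; rewrite /npow /powR pnatr_eq0 /= expRN.
Qed.

Definition dirichlet (R : realType) (c : nat -> R) (s : R) : R :=
  limn (series (fun k => c k.+1 * npow s k.+1)).

Lemma dirichlet_series_continuous (R : realType) (c : nat -> R) N :
  continuous (fun s : R => series (fun k => c k.+1 * npow s k.+1) N).
Proof.
apply: continuous_big; first exact: add_continuous.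
by move=> k _ s; apply: cvgM; [exact: cvg_cst|exact: npow_continuous].
Qed.

(** For t > r, with r halfway between 1 and s, all tails are bounded by the tail of zeta(r), and the
    partial sums are continuous. *)
Lemma dirichlet_continuous (R : realType) (c : nat -> R) (s : R) :
  (forall n, `|c n| <= 1) -> 1 < s -> {for s, continuous (dirichlet c)}.
Proof.
move=> c1 s1; pose r := (1 + s) / 2; have [r1 rs] : 1 < r /\ r < s by rewrite /r; lra.
have cr := npow_series_cvg r1.
pose Z := series (fun k => npow r k.+1).
have tail N t : r < t ->
    `|dirichlet c t - series (fun k => c k.+1 * npow t k.+1) N| <= limn Z - Z N.
  move=> rt; apply: dominated_series_tail cr => k.
  rewrite normrM [X in _ * X]ger0_norm ?npow_ge0 // -[leRHS]mul1r.
  apply: ler_pM; rewrite ?npow_ge0 //.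
  case: k => [|k]; first by rewrite !npow1.
  exact/ltW/npow_lt.
apply/cvgrPdist_le => e e0.
have e3 : 0 < e / 3 by lra.
have /cvgrPdist_le /(_ _ e3) [N _ /(_ N (leqnn N)) hN] := cr.
have hZ : limn Z - Z N <= e / 3 := le_trans (ler_norm _) hN.
have /cvgrPdist_le /(_ _ e3) fin := @dirichlet_series_continuous R c N s.
near=> t.
have h1 := le_trans (tail N s rs) hZ.
have h2 : `|dirichlet c t - series (fun k => c k.+1 * npow t k.+1) N| <= e / 3.
  apply: le_trans (tail N t _) hZ.
  near: t; exact: lt_nbhsr.
have h3 : `|series (fun k => c k.+1 * npow s k.+1) N -
            series (fun k => c k.+1 * npow t k.+1) N| <= e / 3.
  by near: t.
move: h1 h2 h3; rewrite !ler_norml => /andP[? ?] /andP[? ?] /andP[? ?].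
by apply/andP; split; lra.
Unshelve. all: by end_near.
Qed.

Lemma dirichlet_euler (R : realType) (c : nat -> R) (s : R) :
  c 1%N = 1 ->
  (forall p m, prime p -> (0 < m)%N -> c (p * m)%N = c p * c m) ->
  (forall n, `|c n| <= 1) -> 1 < s ->
  (\prod_(0 <= p < P | prime p) (1 - c p * npow s p) * dirichlet c s
     @[P --> \oo] --> (1 : R))%classic.
Proof.
move=> c1 cM ca s1.
apply: (@euler_product R (fun n => c n * npow s n) (npow s)).
- by rewrite c1 npow1 mulr1.
- by move=> p m pp m0; rewrite cM // npowM mulrACA.
- move=> n; rewrite normrM [X in _ * X]ger0_norm ?npow_ge0 // -[leRHS]mul1r.
  by apply: ler_wpM2r; rewrite ?npow_ge0.
- exact: npow_series_cvg.
Qed.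

Lemma zetaE (R : realType) (s : R) : zeta s = dirichlet (fun=> 1) s.
Proof.
by rewrite /zeta /dirichlet; congr (limn (series _)); apply/funext=> k; rewrite mul1r.
Qed.

Lemma zeta_ge_series (R : realType) (s : R) N : 1 < s ->
  series (fun k => npow s k.+1) N <= zeta s.
Proof.
move=> s1; apply: nondecreasing_cvgn_le; last exact: npow_series_cvg.
by apply: nondecreasing_series => k _ _; exact: npow_ge0.
Qed.

Lemma zeta_le (R : realType) (s : R) : 1 < s -> zeta s <= (1 - 2 * npow s 2)^-1.
Proof.
move=> s1; apply: (limr_le (npow_series_cvg s1)).
by apply: nearW => N; exact: npow_series_le.
Qed.

Lemma zeta_ge1 (R : realType) (s : R) : 1 < s -> 1 <= zeta s.
Proof.
move=> s1; apply: le_trans (zeta_ge_series 1 s1).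
by rewrite /series /= big_nat1 npow1.
Qed.

Lemma dirichlet_dist1 (R : realType) (c : nat -> R) (s : R) : c 1%N = 1 ->
  (forall n, `|c n| <= 1) -> 1 < s -> `|dirichlet c s - 1| <= zeta s - 1.
Proof.
move=> c1 ca s1.
have := @dominated_series_tail R (fun k => c k.+1 * npow s k.+1)
  (fun k => npow s k.+1) 1 _ (npow_series_cvg s1).
rewrite /series /= !big_nat1 c1 npow1 mulr1; apply => k.
rewrite normrM [X in _ * X]ger0_norm ?npow_ge0 // -[leRHS]mul1r.
by apply: ler_wpM2r; rewrite ?npow_ge0.
Qed.

(** A harmonic partial sum above [M] stays above [M] for exponents slightly larger than 1, and it
    bounds zeta from below there. *)
Lemma zeta_unbounded (R : realType) (M : R) : exists2 s : R, 1 < s & M < zeta s.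
Proof.
have [N hN] : exists N, M < series (@harmonic R) N.
  apply: contrapT => /forallNP h; apply: (@dvg_harmonic R).
  apply: nondecreasing_is_cvgn.
    by apply: nondecreasing_series => k _ _; exact: harmonic_ge0.
  by exists M => _ [N _ <-]; rewrite leNgt; apply/negP/h.
have cN := @dirichlet_series_continuous R (fun=> 1) N 1.
have h1 : M < series (fun k => 1 * npow 1 k.+1) N.
  rewrite (_ : (fun k => _) = @harmonic R) //; apply/funext => k.
  by rewrite mul1r /npow powRr1 // /harmonic.
have : (\forall t \near (1 : R), M < series (fun k => 1 * npow t k.+1) N)%classic.
  exact: (cvgr_gt _ cN) h1.
move=> /nbhs_ballP [e /= e0 /(_ (1 + e / 2))].
have e2 : 0 < e / 2 by lra.
rewrite /ball /= opprD addrA subrr add0r normrN gtr0_norm // => /(_ ltac:(lra)) h.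
exists (1 + e / 2); first lra.
apply: lt_le_trans h _; apply: le_trans (zeta_ge_series N _); last lra.
by rewrite /series /=; under eq_bigr do rewrite mul1r.
Qed.

(** * The Kronecker symbol *)

Lemma kronecker_prime_norm (a p : nat) : `|kronecker_prime a p| <= 1.
Proof. by rewrite /kronecker_prime; do ?case: ifP. Qed.

(** With one common range of primes, the products for n and p * n can be compared factor by
    factor. *)
Lemma kroneckerE a n B : (0 < n < B)%N ->
  kronecker a n = \prod_(0 <= p < B | prime p) kronecker_prime a p ^+ logn p n.
Proof.
move=> /andP[n0 nB]; rewrite /kronecker gtn_eqF //.
rewrite [RHS](bigID [in primes n]) /= [X in _ * X]big1 ?mulr1 => [|p]; last first.
  by rewrite -logn_gt0 lt0n negbK => /andP[_ /eqP ->]; rewrite expr0.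
rewrite -[RHS]big_filter; apply: perm_big; apply: uniq_perm.
- exact: primes_uniq.
- by rewrite filter_uniq ?iota_uniq.
move=> p; rewrite mem_filter mem_index_iota /= andbC.
apply/idP/idP => [pn|/andP[_ /andP[]//]].
rewrite pn andbT; move: pn; rewrite mem_primes n0 => /and3P[-> _ /(dvdn_leq n0) pn].
by rewrite andbT (leq_ltn_trans pn nB).
Qed.

Lemma kronecker1 a : kronecker a 1 = 1.
Proof. by rewrite /kronecker /= big_nil. Qed.

Lemma kronecker_primeM a p n : prime p -> (0 < n)%N ->
  kronecker a (p * n) = kronecker_prime a p * kronecker a n.
Proof.
move=> pp n0; have p0 := prime_gt0 pp.
rewrite !(@kroneckerE _ _ (p * n).+1) ?muln_gt0 ?p0 ?n0 ?ltnS ?leqnn ?leq_pmull //.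
under eq_bigr => q qq do rewrite lognM // exprD.
rewrite big_split /=; congr (_ * _).
rewrite -big_filter (bigD1_seq p) ?filter_uniq ?iota_uniq //=; last first.
  by rewrite mem_filter pp mem_iota /= p0 add1n ltnS leq_pmulr.
rewrite logn_prime // eqxx expr1 big1 ?mulr1 // => q qp.
by rewrite logn_prime // (negbTE qp) expr0.
Qed.

Lemma kronecker_at_prime a p : prime p -> kronecker a p = kronecker_prime a p.
Proof. by move=> pp; rewrite -[p]muln1 kronecker_primeM // kronecker1 mulr1 muln1. Qed.

Lemma kronecker_norm a n : `|kronecker a n| <= 1.
Proof.
rewrite /kronecker; case: ifP => _; first by case: (a == 1%N).
apply: (big_ind (fun x : int => `|x| <= 1)) => // [x y hx hy|p _].
  by rewrite normrM mulr_ile1.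
by rewrite normrX exprn_ile1 ?kronecker_prime_norm.
Qed.

Lemma chi_norm (R : realType) d n : `|(chi d n)%:~R : R| <= 1.
Proof.
by have := kronecker_norm (fund_disc d) n; rewrite -(ler_int R) intr_norm.
Qed.

Lemma chiM d p m : prime p -> (0 < m)%N -> chi d (p * m)%N = chi d p * chi d m.
Proof. by move=> pp m0; rewrite /chi kronecker_primeM // (kronecker_at_prime _ pp). Qed.

Lemma chi_dvd d p : prime p -> (p %| d)%N -> chi d p = 0.
Proof.
move=> pp pd; rewrite /chi kronecker_at_prime // /kronecker_prime.
have pD : (p %| fund_disc d)%N.
  by rewrite /fund_disc; case: ifP => // _; rewrite dvdn_mull.
case: eqP => [p2|_]; last by rewrite pD.
suff -> : ~~ odd (fund_disc d) by [].
by rewrite -dvdn2 -p2.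
Qed.

Lemma chi_split d p : prime p -> p != 2%N -> ~~ (p %| d)%N -> chi d p = 1 ->
  exists x : nat, (x ^ 2 = d %[mod p])%N.
Proof.
move=> pp p2 pd; rewrite /chi kronecker_at_prime // /kronecker_prime (negbTE p2).
case: ifP => // _; case: existsP => // -[x /eqP hx] _.
move: hx; rewrite /fund_disc; case: ifP => [_|_ hx]; first by exists x.
(* [h] inverts 2 modulo p and so turns a root of 4d into a root of d. *)
pose h := (p.+1 %/ 2)%N.
have podd : odd p by case/even_prime: pp => // /eqP; rewrite (negbTE p2).
have h2 : (2 * h = p + 1)%N by rewrite /h; lia.
exists (h * x)%N.
have -> : ((h * x) ^ 2 = d * (2 * h) ^ 2 %[mod p])%N.
  by rewrite !expnMn -modnMmr hx modnMmr; congr (_ %% _)%N; ring.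
by rewrite h2 -modnMmr -modnXm modnDl modnXm exp1n modnMmr muln1.
Qed.

(** * Counting square roots of d modulo n *)

Local Open Scope nat_scope.

(** A prime divisor of d has exponent exactly 1 in d, so for y > 0 its exponent would be even on the
    left and odd on the right. *)
Lemma squarefree_nonsquare d x y : 1 < d -> squarefree d -> x ^ 2 = d * y ^ 2 -> y = 0.
Proof.
move=> d1 sf e; apply/eqP; rewrite -leqn0 leqNgt; apply/negP => y0.
have x0 : 0 < x by case: x e => // e; nia.
have pd := pdiv_prime d1; set q := pdiv d in pd.
have l1 : logn q d = 1.
  apply/eqP; rewrite eqn_leq logn_gt0 mem_primes pd (ltnW d1) pdiv_dvd !andbT.
  rewrite leqNgt; apply/negP; rewrite -pfactor_dvdn ?(ltnW d1) // => /sf q1.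
  by rewrite q1 in pd.
have := congr1 (logn q) e; rewrite lognM ?expn_gt0 ?y0 //; last by lia.
by rewrite !lognX l1; lia.
Qed.

Lemma floor_sqrt n : exists m, m ^ 2 <= n < m.+1 ^ 2.
Proof.
elim: n => [|n [m /andP[h1 h2]]]; first by exists 0.
have [h|h] := leqP (m.+1 ^ 2) n.+1; [exists m.+1|exists m]; nia.
Qed.

Lemma dvdn_divgcd n a b : 0 < n -> n %| a * b -> n %/ gcdn b n %| a.
Proof.
move=> n0; have [g eg] : exists g, g = gcdn b n by exists (gcdn b n).
have g0 : 0 < g by rewrite eg gcdn_gt0 n0 orbT.
have [b' eb] : exists b', b = b' * g by apply/dvdnP; rewrite eg dvdn_gcdl.
have [n' en] : exists n', n = n' * g by apply/dvdnP; rewrite eg dvdn_gcdr.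
have cop : coprime n' b'.
  by rewrite /coprime -(eqn_pmul2r g0) mul1n muln_gcdl -en -eb gcdnC eg.
rewrite -eg en eb mulnK // mulnA dvdn_pmul2r //.
by rewrite Gauss_dvdl.
Qed.

(** * Thue vectors and the encoding of roots *)

Local Open Scope ring_scope.

(** Pigeonhole: with m the integer square root of n, the (m + 1)^2 > n pairs (a, b) collide under a
    - t b modulo n, where n - t stands for -t. The difference of two colliding pairs is the
    vector. *)
Lemma thue (n t : nat) : (t < n)%N -> exists x y : int,
  [/\ (x != 0) || (y != 0), x ^+ 2 <= n%:Z, y ^+ 2 <= n%:Z
    & exists u : int, x = t%:Z * y + n%:Z * u].
Proof.
move=> tn; have n0 : (0 < n)%N by lia.
have [m /andP[m1 m2]] := floor_sqrt n.
pose f (w : 'I_m.+1 * 'I_m.+1) : 'I_n :=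
  Ordinal (ltn_pmod (w.1 + (n - t) * w.2) n0).
have /injectivePn [[u v] [[u' v'] neq e]] : ~~ injectiveb f.
  apply/negP => /injectiveP /leq_card.
  by rewrite card_prod !card_ord leqNgt -[(_ * _)%N]/(m.+1 ^ 2)%N m2.
exists (u%:Z - u'%:Z), (v%:Z - v'%:Z).
have um := ltn_ord u; have um' := ltn_ord u'.
have vm := ltn_ord v; have vm' := ltn_ord v'.
split.
- apply: contraNT neq; rewrite negb_or !negbK !subr_eq0 => /andP[/eqP[h1] /eqP[h2]].
  by apply/eqP; congr (_, _); apply: val_inj.
- nia.
- nia.
have {e} := congr1 val e; rewrite /f /=.
set a := (_ + _)%N; set b := (_ + _)%N => e.
have ea := divn_eq a n; have eb := divn_eq b n.
exists ((a %/ n)%N%:Z - (b %/ n)%N%:Z - (v%:Z - v'%:Z)).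
move: ea eb; rewrite e; set r := (_ %% _)%N; rewrite /a /b.
move: (_ %/ _)%N (_ %/ _)%N r => A B r; nia.
Qed.

(** The factor gcd(y, n) beyond n is what later bounds this gcd by d, hence the number of roots t
    sharing one vector and one modulus. *)
Lemma norm_form_multiple (d n t : nat) (x y u w : int) : (0 < n)%N ->
  t%:Z ^+ 2 - d%:Z = n%:Z * w -> x = t%:Z * y + n%:Z * u ->
  exists v : int, x ^+ 2 - d%:Z * y ^+ 2 = n%:Z * ((gcdn `|y| n)%:Z * v).
Proof.
move=> n0 ew ex.
have [n' en] := dvdnP (dvdn_gcdr `|y| n).
have : ((gcdn `|y| n)%:Z %| y)%Z by rewrite dvdzE dvdn_gcdl.
move=> /dvdzP [y' ey].
set g := gcdn `|y| n in en ey *.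
exists (g%:Z * w * y' ^+ 2 + 2 * t%:Z * y' * u + n'%:Z * u ^+ 2).
have eN : n%:Z = n'%:Z * g%:Z by rewrite -PoszM -en.
have -> : d%:Z = t%:Z ^+ 2 - n%:Z * w by rewrite -ew; ring.
rewrite ex ey eN; ring.
Qed.

Lemma absz_sub_le (a b c : int) : 0 <= a <= c -> 0 <= b <= c ->
  (absz (a - b)%R <= absz c)%N.
Proof. lia. Qed.

Lemma shift_sqr_le (x : int) (n N M : nat) :
  x ^+ 2 <= n%:Z -> (n <= N)%N -> (N < M.+1 ^ 2)%N ->
  (absz (x + M%:Z)%R < (2 * M).+1)%N /\ (absz (x + M%:Z)%R)%:Z - M%:Z = x.
Proof.
move=> xn nN NM; have [x1 x2] : - M%:Z <= x /\ x <= M%:Z by split; nia.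
by clear xn nN NM; split; lia.
Qed.

(* A square root t of d modulo n is recovered from a Thue vector (x, y), which
   determines n once k is known, and t modulo n / gcd(y, n); the digit j then
   gives t itself. *)
Definition encodes (d n t : nat) (x y : int) (k j : nat) : Prop :=
  [/\ (n * k.+1)%N = absz (x ^+ 2 - d%:Z * y ^+ 2)%R,
      (t %/ (n %/ gcdn `|y| n))%N = j
    & exists u : int, x = t%:Z * y + n%:Z * u].

Lemma encodes_inj d n t n' t' x y k j : (t < n)%N -> (t' < n')%N ->
  encodes d n t x y k j -> encodes d n' t' x y k j -> n = n' /\ t = t'.
Proof.
move=> tn tn' [hn ht [u hu]] [hn' ht' [u' hu']].
have nn' : n = n' by apply/eqP; rewrite -(eqn_pmul2r (ltn0Sn k)) hn hn'.
subst n'; split=> //; have n0 := leq_ltn_trans (leq0n t) tn.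
(* Subtracting the two congruences gives n | (t - t') y. *)
have h : (n %/ gcdn `|y| n %| absz (t%:Z - t'%:Z)%R)%N.
  apply: dvdn_divgcd => //; rewrite -abszM -[n]absz_nat -dvdzE.
  apply/dvdzP; exists (u' - u); apply/eqP; rewrite -subr_eq0.
  rewrite (_ : _ - _ = t%:Z * y + n%:Z * u - (t'%:Z * y + n%:Z * u')); last by ring.
  by rewrite -hu -hu' subrr.
set m := (n %/ _)%N in ht ht' h.
rewrite (divn_eq t m) (divn_eq t' m) ht ht'; congr (_ + _)%N.
apply/eqP; move: h.
wlog le : t t' {tn tn' ht ht' hu hu'} / (t' <= t)%N.
  by move=> H h; case/orP: (leq_total t' t) => le; [exact: H|
    rewrite eq_sym; apply: H; rewrite // distnC].
by rewrite distnEl // -eqn_mod_dvd.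
Qed.

(** Both x^2 and d y^2 lie in [0, n d], so the nonzero norm n g v, with g = gcd(y, n), satisfies g
    |v| <= d. This bounds k and j. *)
Lemma encodes_exists d n t : (1 < d)%N -> squarefree d -> (t < n)%N ->
  (t ^ 2 = d %[mod n])%N ->
  exists x y k j, [/\ x ^+ 2 <= n%:Z, y ^+ 2 <= n%:Z, (k < d)%N, (j < d)%N
    & encodes d n t x y k j].
Proof.
move=> d1 sf tn e; have n0 := leq_ltn_trans (leq0n t) tn.
have [w ew] : exists w : int, t%:Z ^+ 2 - d%:Z = n%:Z * w.
  exists ((t ^ 2 %/ n)%N%:Z - (d %/ n)%N%:Z).
  have := divn_eq (t ^ 2) n; have := divn_eq d n; rewrite e; nia.
have [x [y [xy0 xn yn [u xu]]]] := thue tn.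
have [v hv] := norm_form_multiple n0 ew xu.
set g := gcdn `|y| n in hv.
have g0 : (0 < g)%N by rewrite gcdn_gt0 n0 orbT.
have Q0 : x ^+ 2 - d%:Z * y ^+ 2 != 0.
  apply: contraTneq xy0 => Q0.
  have h : (`|x| ^ 2 = d * `|y| ^ 2)%N.
    by move/eqP: Q0; rewrite subr_eq0 => /eqP /(congr1 absz); rewrite abszM !abszX.
  have y0 := squarefree_nonsquare d1 sf h.
  move/eqP: h; rewrite y0 exp0n // muln0 expn_eq0 andbT => x0.
  by rewrite negb_or !negbK -!absz_eq0 x0 y0.
have v0 : v != 0 by apply: contraNneq Q0 => v0; rewrite hv v0 !mulr0.
have absQ : absz (x ^+ 2 - d%:Z * y ^+ 2)%R = (n * (g * `|v|))%N.
  by rewrite hv !abszM !absz_nat.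
have v1 : (0 < `|v|)%N by rewrite absz_gt0.
have Qle : (n * (g * `|v|) <= n * d)%N.
  rewrite -absQ -[(n * d)%N]absz_nat; apply: absz_sub_le; rewrite ?sqr_ge0 /=.
    by apply: le_trans xn _; rewrite lez_nat leq_pmulr // ltnW.
  by rewrite mulr_ge0 ?sqr_ge0 //= PoszM mulrC ler_wpM2r.
rewrite leq_pmul2l // in Qle.
exists x, y, (g * `|v|).-1, (t %/ (n %/ g))%N; split => //.
- by rewrite prednK ?muln_gt0 ?g0.
(* The digit is below g because t < n = g * (n / g). *)
- apply: leq_trans (_ : g <= _)%N; last exact: leq_trans (leq_pmulr _ v1) Qle.
  rewrite ltn_divLR ?divn_gt0 // ?(dvdn_leq n0 (dvdn_gcdr _ _)) //.
  by rewrite mulnC divnK // dvdn_gcdr.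
- by split; [rewrite prednK ?muln_gt0 ?g0|by []|exists u].
Qed.

Definition rho (d n : nat) : nat := \sum_(t < n) (t ^ 2 == d %[mod n])%N.

(** Encoding injects the pairs (n, t) into a set of size (2M + 1)^2 d^2, where M is the integer
    square root of N; for N >= 1, 2M + 1 <= 3M and M^2 <= N. *)
Lemma rho_sum_le d N : (1 < d)%N -> squarefree d ->
  (\sum_(0 <= n < N.+1) rho d n <= 9 * d ^ 2 * N)%N.
Proof.
move=> d1 sf; case: N => [|N']; first by rewrite big_nat1 /rho big_ord0.
set N := N'.+1; have [M /andP[M1 M2]] := floor_sqrt N.
pose P := [set p : 'I_N.+1 * 'I_N.+1 | (p.2 < p.1)%N && (p.2 ^ 2 == d %[mod p.1])%N].
have -> : (\sum_(0 <= n < N.+1) rho d n = #|P|)%N.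
  transitivity (\sum_(n < N.+1) \sum_(t < N.+1) ((n, t) \in P))%N; last first.
    rewrite pair_bigA -sum1_card [RHS]big_mkcond.
    by apply: eq_bigr => -[n t] _; case: (_ \in P).
  rewrite big_mkord; apply: eq_bigr => n _.
  rewrite /rho (big_ord_widen N.+1 (fun t => (t ^ 2 == d %[mod n])%N : nat));
    last exact: ltnW.
  by rewrite big_mkcond; apply: eq_bigr => t _; rewrite inE /=; case: ltnP.
pose C := ('I_(2 * M).+1 * 'I_(2 * M).+1 * 'I_d * 'I_d)%type.
have : forall p, exists c : C, p \in P -> encodes d p.1 p.2
    (c.1.1.1%:Z - M%:Z) (c.1.1.2%:Z - M%:Z) c.1.2 c.2.
  move=> [n t]; have [|] := boolP ((n, t) \in P); last first.
    by move=> _; exists (ord0, ord0, Ordinal (ltnW d1), Ordinal (ltnW d1)).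
  rewrite inE /= => /andP[tn /eqP e].
  have [x [y [k [j [xn yn kd jd enc]]]]] := encodes_exists d1 sf tn e.
  have nN : (n <= N)%N by rewrite -ltnS.
  have [xM ex] := shift_sqr_le xn nN M2; have [yM ey] := shift_sqr_le yn nN M2.
  exists (Ordinal xM, Ordinal yM, Ordinal kd, Ordinal jd) => _ /=.
  by rewrite ex ey.
move=> /choice[f hf].
have inj : {in P &, injective f}.
  move=> [n t] [n' t'] p p' e; have := hf _ p; have := hf _ p'; rewrite e /=.
  move: p p'; rewrite !inE /= => /andP[tn _] /andP[tn' _] h' h.
  have [nn tt] := encodes_inj tn tn' h h'.
  by congr (_, _); apply: val_inj.
have := leq_card_in f P inj; rewrite !card_prod !card_ord => h1; apply: leq_trans h1 _.
have : ((2 * M).+1 * (2 * M).+1 <= 9 * N)%N.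
  have M0 : (0 < M)%N by rewrite lt0n; apply: contraTneq M2 => ->.
  have M3 : ((2 * M).+1 <= 3 * M)%N by clear -M0; lia.
  apply: leq_trans (leq_mul M3 M3) _.
  by rewrite mulnACA leq_mul2l /= mulnn.
by move=> h; rewrite -mulnA mulnn mulnAC leq_mul2r h orbT.
Qed.

(** * Boundedness of L *)

Lemma rhoE d n : rho d n = #|[set t : 'I_n | (t ^ 2 == d %[mod n])%N]|.
Proof.
rewrite /rho -sum1_card [RHS]big_mkcond; apply: eq_bigr => t _.
by rewrite inE; case: eqP.
Qed.

(** The Chinese remainder map glues a root modulo m and a root modulo n, injectively. *)
Lemma rhoM_ge d m n : (0 < m)%N -> (0 < n)%N -> coprime m n ->
  (rho d m * rho d n <= rho d (m * n))%N.
Proof.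
move=> m0 n0 cop; have mn0 : (0 < m * n)%N by rewrite muln_gt0 m0.
rewrite !rhoE -cardsX; set W := finset.setX _ _.
pose f (w : 'I_m * 'I_n) : 'I_(m * n) := Ordinal (ltn_pmod (chinese m n w.1 w.2) mn0).
have fm w : f w = w.1 %[mod m] by rewrite /= modn_dvdm ?dvdn_mulr // chinese_modl.
have fn w : f w = w.2 %[mod n] by rewrite /= modn_dvdm ?dvdn_mull // chinese_modr.
have inj : injective f.
  move=> [a b] [a' b'] e; congr (_, _); apply: val_inj.
    by have := fm (a, b); rewrite e fm /= !modn_small.
  by have := fn (a, b); rewrite e fn /= !modn_small.
rewrite -[#|W|](card_imset (mem W) inj); apply: subset_leq_card.
apply/fintype.subsetP => x /imsetP[w]; rewrite !inE => /andP[h1 h2] ->.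
by rewrite chinese_remainder // -modnXm fm modnXm h1 -modnXm fn modnXm h2.
Qed.

(** For distinct primes these are the squarefree integers supported on [l], which index the
    expansion of a product of factors 1 + f(p). *)
Fixpoint subproducts (l : seq nat) : seq nat :=
  if l is p :: l' then subproducts l' ++ [seq (p * n)%N | n <- subproducts l']
  else [:: 1%N].

Lemma subproducts_coprime (l : seq nat) n p : all prime l -> prime p -> p \notin l ->
  n \in subproducts l -> (0 < n)%N && coprime p n.
Proof.
elim: l n => [|q l IH] n /=; first by rewrite inE => _ _ _ /eqP ->; rewrite coprimen1.
move=> /andP[qp lp] pp; rewrite inE negb_or => /andP[pq pl].
rewrite mem_cat => /orP[/IH->//|/mapP[m mD ->]].
have /andP[m0 cop] := IH m lp pp pl mD.
by rewrite muln_gt0 prime_gt0 // m0 coprimeMr cop prime_coprime // dvdn_prime2 // pq.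
Qed.

Lemma subproducts_uniq (l : seq nat) : all prime l -> uniq l -> uniq (subproducts l).
Proof.
elim: l => //= p l IH /andP[pp lp] /andP[pl ul].
rewrite cat_uniq IH // map_inj_uniq ?IH ?andbT //=; last first.
  by move=> a b /eqP; rewrite eqn_pmul2l ?prime_gt0 // => /eqP.
apply/hasPn => _ /mapP[m _ ->]; apply/negP => /(subproducts_coprime lp pp pl).
by rewrite coprimeMr prime_coprime // dvdnn /= andbF.
Qed.

Lemma prod_rho_le (R : realType) (s : R) d (l : seq nat) : all prime l -> uniq l ->
  \prod_(p <- l) (1 + (rho d p)%:R * npow s p) <=
  \sum_(n <- subproducts l) (rho d n)%:R * npow s n.
Proof.
elim: l => [|p l IH] /=.
  by move=> _ _; rewrite big_nil big_seq1 /rho big_ord1 !modn1 npow1 mulr1.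
move=> /andP[pp lp] /andP[pl ul].
rewrite big_cons big_cat big_map /= mulrDl mul1r.
have h := IH lp ul; apply: lerD => //.
have rp : 0 <= (rho d p)%:R * npow s p by rewrite mulr_ge0 ?npow_ge0.
apply: le_trans (ler_wpM2l rp h) _; rewrite mulr_sumr.
rewrite big_seq [leRHS]big_seq; apply: ler_sum => n nl.
have /andP[n0 cop] := subproducts_coprime lp pp pl nl.
rewrite npowM mulrACA -natrM ler_wpM2r ?mulr_ge0 ?npow_ge0 // ler_nat.
exact: rhoM_ge (prime_gt0 pp) n0 cop.
Qed.

Lemma sum_uniq_le (R : numDomainType) (f : nat -> R) (l : seq nat) : uniq l ->
  (forall n, 0 <= f n) ->
  exists N, \sum_(n <- l) f n <= \sum_(0 <= n < N) f n.
Proof.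
move=> ul f0; exists (\max_(n <- l) n).+1.
rewrite [leRHS](bigID [in l]) /= -[leLHS]addr0 lerD ?sumr_ge0 //.
rewrite -[leRHS]big_filter.
rewrite (perm_big [seq n <- index_iota 0 (\max_(n <- l) n).+1 | n \in l]) //.
apply: uniq_perm; rewrite ?filter_uniq ?iota_uniq // => n.
rewrite mem_filter mem_index_iota /= andb_idr // => nl.
by rewrite ltnS; apply: (@leq_bigmax_seq _ _ _ (fun n => n)).
Qed.

(** Abel summation in inductive form: b = C - a has nonnegative partial sums, and the sum of b g
    stays above the partial sum of b times the last value of g. *)
Lemma abel_sum_le (R : numDomainType) (a g : nat -> R) (C : R) N :
  (forall n, 0 <= g n) -> (forall n, g n.+1 <= g n) ->
  (forall n, \sum_(0 <= k < n) a k <= C * n%:R) ->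
  \sum_(0 <= k < N) a k * g k <= C * \sum_(0 <= k < N) g k.
Proof.
move=> g0 gdec aC; rewrite -subr_ge0 mulr_sumr -sumrB.
pose b k := C - a k.
have B0 n : 0 <= \sum_(0 <= k < n) b k.
  by rewrite sumrB subr_ge0 sumr_const_nat subn0 -mulr_natr.
under eq_bigr do rewrite -mulrBl -/(b _).
case: N => [|N]; first by rewrite big_geq.
apply: le_trans (_ : (\sum_(0 <= k < N.+1) b k) * g N <= _).
  by rewrite mulr_ge0.
elim: N => [|N IH]; first by rewrite !big_nat1.
rewrite [leRHS]big_nat_recr //= [X in X * _ <= _]big_nat_recr //= mulrDl lerD2r.
by apply: le_trans IH; rewrite ler_wpM2l.
Qed.

Lemma prod_rho_le_zeta (R : realType) (s : R) d (l : seq nat) :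
  (1 < d)%N -> squarefree d -> 1 < s -> all prime l -> uniq l ->
  \prod_(p <- l) (1 + (rho d p)%:R * npow s p) <= (9 * d ^ 2)%:R * zeta s.
Proof.
move=> d1 sf s1 lp ul; apply: le_trans (prod_rho_le s d lp ul) _.
have f0 n : 0 <= (rho d n)%:R * npow s n by rewrite mulr_ge0 ?npow_ge0.
have [N /le_trans] := sum_uniq_le (subproducts_uniq lp ul) f0; apply.
case: N => [|N].
  by rewrite big_geq // mulr_ge0 // (le_trans ler01) ?zeta_ge1.
(* [rho d 0] is an empty sum, so the sum may start at n = 1. *)
rewrite big_nat_recl // {1}/rho big_ord0 mul0r add0r.
apply: le_trans (_ : (9 * d ^ 2)%:R * series (fun k => npow s k.+1) N <= _); last first.
  by rewrite ler_wpM2l // zeta_ge_series.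
apply: (abel_sum_le (a := fun k => (rho d k.+1)%:R)).
- by move=> n; exact: npow_ge0.
- by move=> n; apply: npow_le; [lra|rewrite /= leqnSn].
move=> n; rewrite -natr_sum -natrM ler_nat.
by have := rho_sum_le n d1 sf; rewrite big_nat_recl // {1}/rho big_ord0 add0n.
Qed.

(** The product of 1 - 1/k^2 over all integers 2 <= k <= m telescopes to (m + 1)/(2m), and
    restricting to primes only increases it. The induction [h] carries this sharper bound with m = n
    + 1. *)
Lemma prod_one_sub_sqr_ge (R : realType) (s : R) P : 1 <= s ->
  2^-1 <= \prod_(0 <= p < P | prime p) (1 - npow s p ^+ 2).
Proof.
move=> s1.
have x_le p : npow s p ^+ 2 <= (p%:R^-1) ^+ 2.
  by rewrite lerXn2r ?nnegrE ?npow_ge0 ?invr_ge0 ?npow_le_inv.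
have h n : n.+2%:R <= 2 * n.+1%:R * \prod_(0 <= p < n.+2 | prime p) (1 - npow s p ^+ 2).
  elim: n => [|n IH].
    by rewrite big_mkcond big_nat_recr //= big_nat1 /= !mulr1.
  rewrite big_mkcond big_nat_recr //= -big_mkcond /=.
  set X := \prod_(0 <= _ < _ | _) _ in IH *.
  have m0 : 0 < n.+1%:R :> R by rewrite ltr0n.
  have : 1 - n.+2%:R^-1 ^+ 2 <= (if prime n.+2 then 1 - npow s n.+2 ^+ 2 else 1 : R).
    case: ifP => _; first by rewrite lerD2l lerN2.
    by rewrite gerBl sqr_ge0.
  move: (if _ then _ else _) => f.
  rewrite -(natr1 n.+2) -(natr1 n.+1) => hf.
  rewrite -(natr1 n.+1) in IH.
  move: (n.+1%:R : R) m0 IH hf => m m0 IH hf.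
  have X0 : 0 <= X by rewrite -(pmulr_rge0 (x := 2 * m)); lra.
  have m1 : 0 < m + 1 by lra.
  apply: le_trans (_ : 2 * (m + 1) * (X * (1 - (m + 1)^-1 ^+ 2)) <= _); last first.
    by rewrite ler_wpM2l ?ler_wpM2l //; lra.
  have -> : 2 * (m + 1) * (X * (1 - (m + 1)^-1 ^+ 2)) =
      2 * m * X * (m + 1 + 1) / (m + 1) by field; rewrite gt_eqF.
  rewrite ler_pdivlMr // mulrC ler_wpM2r //; lra.
case: P => [|[|P]].
- by rewrite big_geq //; lra.
- by rewrite big_mkcond big_nat1 /=; lra.
have := h P; set X := \prod_(0 <= _ < _ | _) _.
have : 1 <= P.+1%:R :> R by rewrite ler1n.
rewrite -[P.+2]addn1 natrD => h1 h2.
have : 0 <= (2 * X - 1) * P.+1%:R by lra.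
rewrite pmulr_lge0; lra.
Qed.

Lemma chi_unit d p : prime p -> p != 2%N -> ~~ (p %| d)%N ->
  chi d p = 1 \/ chi d p = -1.
Proof.
move=> pp p2 pd; rewrite /chi kronecker_at_prime // /kronecker_prime (negbTE p2).
rewrite ifF; first by case: ifP => _; [left|right].
apply/negbTE; rewrite /fund_disc; case: ifP => // _.
rewrite Euclid_dvdM // (negbTE pd) orbF -[4%N]/(2 * 2)%N Euclid_dvdM // dvdn_prime2 //.
by rewrite (negbTE p2).
Qed.

Lemma rho_gt0 d p : (0 < p)%N -> (p %| d)%N -> (1 <= rho d p)%N.
Proof.
case: p => // p _ pd; rewrite /rho (bigD1 ord0) //= exp0n // mod0n.
by rewrite eq_sym -/(dvdn _ _) pd.
Qed.

(** The roots t and p - t differ because p is odd; t is nonzero because p does not divide d. *)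
Lemma rho_ge2 d p : prime p -> p != 2%N -> ~~ (p %| d)%N -> chi d p = 1 ->
  (2 <= rho d p)%N.
Proof.
move=> pp p2 pd /(chi_split pp p2 pd)[x hx].
have p0 := prime_gt0 pp.
pose t := (x %% p)%N; have tp : (t < p)%N by rewrite ltn_pmod.
have ht : (t ^ 2 = d %[mod p])%N by rewrite modnXm.
have t0 : (0 < t)%N.
  rewrite lt0n; apply: contraNneq pd => t0.
  by rewrite /dvdn -ht t0 exp0n // mod0n.
have up : (p - t < p)%N by lia.
have hu : ((p - t) ^ 2 = d %[mod p])%N.
  rewrite -ht -(modnMDl t ((p - t) ^ 2)) -(modnMDl (p - t) (t ^ 2)).
  have e a b c : (c = a + b -> b * c + a ^ 2 = a * c + b ^ 2)%N by move=> ->; ring.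
  by rewrite (e (p - t)%N t p (esym (subnK (ltnW tp)))).
have tu : (t == p - t)%N = false.
  apply/eqP => e; have /even_prime[/eqP|] := pp; first by rewrite (negbTE p2).
  by rewrite -(subnK (ltnW tp)) -e addnn odd_double.
suff : (#|[set Ordinal tp; Ordinal up]| <= rho d p)%N by rewrite cards2 -val_eqE /= tu.
rewrite rhoE; apply: subset_leq_card; apply/fintype.subsetP => z.
by rewrite !inE => /orP[] /eqP ->; apply/eqP.
Qed.

(* Comparing the Euler factors of 1 / zeta(2s)^3, of the rho-series and of
   zeta L; the factor 4 absorbs the prime 2, where chi is not compared to rho. *)
Lemma local_factor_le (R : realType) d p (x : R) : prime p -> 0 < x <= 2^-1 ->
  (1 - x ^+ 2) ^+ 3 <= (if p == 2%N then 4 else 1) *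
    ((1 + (rho d p)%:R * x) * ((1 - x) * (1 - (chi d p)%:~R * x))).
Proof.
move=> pp /andP[x0 x2].
have y1 : 0 <= 1 - x ^+ 2 <= 1 by nra.
have y3 : (1 - x ^+ 2) ^+ 3 <= 1 - x ^+ 2.
  by rewrite exprS ler_piMr ?exprn_ile1; case/andP: y1.
have r0 : 0 <= (rho d p)%:R :> R by [].
case: eqP => [p2|/eqP p2].
  have := chi_norm R d p; rewrite ler_norml => /andP[_ c2].
  have h1 : 2^-1 <= 1 - x by lra.
  have h2 : 2^-1 <= 1 - (chi d p)%:~R * x.
    have : (chi d p)%:~R * x <= 1 * x by rewrite ler_wpM2r // ltW.
    lra.
  have h3 : 1 <= 1 + (rho d p)%:R * x by rewrite lerDl mulr_ge0 // ltW.
  have h4 : 2^-1 * 2^-1 <= (1 - x) * (1 - (chi d p)%:~R * x) by rewrite ler_pM ?invr_ge0.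
  have h5 : 1 * (2^-1 * 2^-1) <=
      (1 + (rho d p)%:R * x) * ((1 - x) * (1 - (chi d p)%:~R * x)).
    by rewrite ler_pM // mulr_ge0 ?invr_ge0.
  lra.
rewrite mul1r.
have [pd|pd] := boolP (p %| d)%N.
  have r1 : 1 <= (rho d p)%:R :> R by rewrite ler1n rho_gt0 ?prime_gt0.
  rewrite chi_dvd // mul0r subr0 mulr1; apply: le_trans y3 _.
  rewrite (_ : 1 - x ^+ 2 = (1 + x) * (1 - x)); last by ring.
  by rewrite ler_wpM2r ?lerD2l ?ler_peMl //; lra.
have [c1|c1] := chi_unit pp p2 pd; rewrite c1.
  have r2 : 2 <= (rho d p)%:R :> R by rewrite (ler_nat R 2) rho_ge2.
  (* This case dictates the exponent 3: dividing by (1 - x)^2 leaves (1 - x)(1 + x)^3 <= 1 + 2x,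
     whereas exponent 2 would leave (1 + x)^2, which exceeds 1 + 2x. *)
  rewrite mul1r; apply: le_trans (_ : (1 + 2 * x) * ((1 - x) * (1 - x)) <= _).
    rewrite -subr_ge0.
    rewrite (_ : _ - _ = x ^+ 3 * (2 + x) * ((1 - x) * (1 - x))); last by ring.
    by rewrite !mulr_ge0 ?exprn_ge0 //; lra.
  by rewrite ler_wpM2r ?mulr_ge0 //; [lra|lra|rewrite lerD2l ler_wpM2r // ltW].
have h3 : 1 <= 1 + (rho d p)%:R * x by rewrite lerDl mulr_ge0 // ltW.
rewrite mulN1r opprK; apply: le_trans y3 _.
rewrite (_ : (1 - x) * (1 + x) = 1 - x ^+ 2); last by ring.
by rewrite ler_peMl //; case/andP: y1.
Qed.

(** Places a constant at a single prime of an Euler product: the loss 4 at p = 2, and later the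
    strict gain at a prime dividing d. *)
Lemma prod_if_eq (R : numDomainType) (a : R) q P :
  \prod_(0 <= p < P | prime p) (if p == q then a else 1) =
  if prime q && (q < P)%N then a else 1.
Proof.
elim: P => [|P IH]; first by rewrite big_geq // andbF.
rewrite big_mkcond big_nat_recr //= -big_mkcond IH ltnS (leq_eqVlt q P).
have [->|_] := eqVneq P q; first by rewrite ltnn andbF mul1r andbT.
by rewrite if_same mulr1.
Qed.

Lemma npow_prime_le (R : realType) (s : R) p : 1 < s -> prime p ->
  0 < npow s p <= 2^-1.
Proof.
move=> s1 pp; rewrite npow_gt0 ?prime_gt0 //=.
apply: le_trans (npow_le_inv p (ltW s1)) _.
by rewrite lef_pV2 ?posrE ?ltr0n ?prime_gt0 // ler_nat prime_gt1.
Qed.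

Lemma LchiE (R : realType) d (s : R) :
  Lchi d s = dirichlet (fun n => (chi d n)%:~R) s.
Proof. by []. Qed.

Lemma chi1 d : chi d 1 = 1.
Proof. exact: kronecker1. Qed.

Lemma zeta_euler (R : realType) (s : R) : 1 < s ->
  (\prod_(0 <= p < P | prime p) (1 - npow s p) * zeta s @[P --> \oo] --> (1 : R))%classic.
Proof.
move=> s1; have := @dirichlet_euler R (fun=> 1) s erefl.
rewrite -zetaE; under eq_fun do under eq_bigr do rewrite mul1r.
by apply=> // *; rewrite ?mulr1 ?normr1.
Qed.

Lemma Lchi_euler (R : realType) d (s : R) : 1 < s ->
  (\prod_(0 <= p < P | prime p) (1 - (chi d p)%:~R * npow s p) * Lchi d s
    @[P --> \oo] --> (1 : R))%classic.
Proof.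
move=> s1; apply: dirichlet_euler => //.
- by rewrite chi1.
- by move=> p m pp m0; rewrite chiM // rmorphM.
- by move=> n; exact: chi_norm.
Qed.

Lemma local_chi_gt0 (R : realType) d (s : R) p : 1 < s -> prime p ->
  0 < 1 - (chi d p)%:~R * npow s p.
Proof.
move=> s1 pp; have /andP[x0 x2] := npow_prime_le s1 pp.
have := chi_norm R d p; rewrite ler_norml => /andP[_ c2].
have : (chi d p)%:~R * npow s p <= 1 * npow s p by rewrite ler_wpM2r // ltW.
lra.
Qed.

(** L times a product of positive factors tends to 1, so it is positive for some [P]. *)
Lemma Lchi_gt0 (R : realType) d (s : R) : 1 < s -> 0 < Lchi d s.
Proof.
move=> s1; have /(cvgr_gt (1 : R)) /(_ _ ltr01) [P _ /(_ P (leqnn P))] /= :=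
  Lchi_euler d s1.
rewrite pmulr_rgt0 //; apply: prodr_gt0 => p pp; exact: local_chi_gt0.
Qed.

(** The constant 32 is 4 * 2^3: the local comparison loses 4 at p = 2, and the cubed product of 1 -
    p^(-2s) is at least 2^-3. *)
Lemma Lchi_le (R : realType) d (s : R) : (1 < d)%N -> squarefree d -> 1 < s ->
  Lchi d s <= 32 * (9 * d ^ 2)%:R.
Proof.
move=> d1 sf s1.
pose E P := \prod_(0 <= p < P | prime p) (1 - npow s p).
pose F P := \prod_(0 <= p < P | prime p) (1 - (chi d p)%:~R * npow s p).
set C := (9 * d ^ 2)%:R.
have C0 : 0 < C :> R by rewrite ltr0n muln_gt0 expn_gt0 (ltnW d1).
have z0 := lt_le_trans ltr01 (zeta_ge1 s1).
have L0 := Lchi_gt0 d s1.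
have EF P : 1 <= 32 * C * zeta s * (E P * F P).
  have h1 : (2^-1 : R) ^+ 3 <=
      \prod_(0 <= p < P | prime p) (1 - npow s p ^+ 2) ^+ 3.
    rewrite prodrXl lerXn2r ?nnegrE ?invr_ge0 //; last first.
      exact: prod_one_sub_sqr_ge (ltW s1).
    by apply: le_trans (prod_one_sub_sqr_ge P (ltW s1)); rewrite invr_ge0.
  pose G P := \prod_(0 <= p < P | prime p) (1 + (rho d p)%:R * npow s p).
  have h2 : \prod_(0 <= p < P | prime p) (1 - npow s p ^+ 2) ^+ 3 <=
      4 * (G P * (E P * F P)).
    apply: le_trans (_ : \prod_(0 <= p < P | prime p) ((if p == 2%N then 4 else 1) *
       ((1 + (rho d p)%:R * npow s p) *
       ((1 - npow s p) * (1 - (chi d p)%:~R * npow s p)))) <= _).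
      apply: ler_prod => p pp; have x2 := npow_prime_le s1 pp.
      rewrite local_factor_le // andbT exprn_ge0 //.
      by case/andP: x2 => ? ?; nra.
    rewrite !big_split /=; apply: ler_wpM2r; last first.
      by rewrite prod_if_eq; case: ifP; rewrite ?ler1n.
    rewrite !mulr_ge0 //; apply: prodr_ge0 => p pp;
      have /andP[x0 x2] := npow_prime_le s1 pp.
    - by rewrite addr_ge0 // mulr_ge0 // ltW.
    - lra.
    - exact/ltW/local_chi_gt0.
  have h3 : G P <= C * zeta s.
    rewrite /G -big_filter; apply: prod_rho_le_zeta => //.
      exact: filter_all.
    by rewrite filter_uniq // iota_uniq.
  have EF0 : 0 <= E P * F P.
    rewrite mulr_ge0 //; apply: prodr_ge0 => p pp.
      by have /andP[x0 x2] := npow_prime_le s1 pp; lra.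
    exact/ltW/local_chi_gt0.
  have h4 := ler_wpM2r EF0 h3; lra.
have lim : (E P * zeta s * (F P * Lchi d s) @[P --> \oo] --> (1 : R))%classic.
  rewrite -[X in (_ --> X)%classic]mulr1.
  by apply: cvgM; [exact: zeta_euler|exact: Lchi_euler].
have C32 : 0 < 32 * C by rewrite mulr_gt0.
(* Multiplying [EF] by L bounds L / (32 C) by a sequence tending to 1. *)
have : Lchi d s / (32 * C) <= 1.
  rewrite -[leRHS](cvg_lim _ lim) //; apply: limr_ge; first exact: cvgP lim.
  apply: nearW => P; rewrite ler_pdivrMr //.
  have := ler_wpM2r (ltW L0) (EF P); rewrite mul1r => /le_trans; apply.
  by rewrite le_eqVlt; apply/orP; left; apply/eqP; ring.
by rewrite ler_pdivrMr ?mul1r.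
Qed.

(** * The sign of N *)

(** Cross-multiplied form of the strict decrease of zeta / L, obtained from finite Euler
    products. *)
Lemma zeta_Lchi_decreasing (R : realType) d (s t : R) : (1 < d)%N -> 1 < s -> s < t ->
  zeta t * Lchi d s < zeta s * Lchi d t.
Proof.
move=> d1 s1 st; have t1 := lt_trans s1 st.
pose E (u : R) P := \prod_(0 <= p < P | prime p) (1 - npow u p).
pose F (u : R) P := \prod_(0 <= p < P | prime p) (1 - (chi d p)%:~R * npow u p).
have qP := pdiv_prime d1; have cq := chi_dvd qP (pdiv_dvd d).
set q := pdiv d in qP cq.
(* At q | d, where chi vanishes, the factors at s and t have the fixed ratio k < 1. This gap does
   not depend on [P], so strictness survives the limit. *)
pose k := (1 - npow s q) / (1 - npow t q).
have xy p : prime p -> npow t p < npow s p by move=> pp; rewrite npow_lt ?prime_gt1.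
have xq := npow_prime_le s1 qP; have yq := npow_prime_le t1 qP.
have k1 : k < 1 by rewrite ltr_pdivrMr ?mul1r; have := xy q qP; lra.
have k0 : 0 <= k by rewrite divr_ge0; lra.
have le P : (q < P)%N -> E s P * F t P <= k * (E t P * F s P).
  move=> qltP.
  have kE : \prod_(0 <= p < P | prime p) (if p == q then k else 1) = k.
    by rewrite prod_if_eq qP qltP.
  rewrite -[k in leRHS]kE.
  rewrite /E /F -!big_split /=; apply: ler_prod => p pp.
  have /andP[x0 x2] := npow_prime_le s1 pp; have /andP[y0 y2] := npow_prime_le t1 pp.
  have cs := local_chi_gt0 d s1 pp; have ct := local_chi_gt0 d t1 pp.
  rewrite mulr_ge0 //=; [|lra|exact: ltW].
  case: eqP => [->|_].
    rewrite cq !mul0r !subr0 !mulr1 /k divfK //; lra.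
  rewrite mul1r -subr_ge0.
  (* Monotonicity of a local factor: the cross difference is (1 - chi(p)) (p^-s - p^-t), and chi(p)
     <= 1. *)
  rewrite (_ : _ - _ = (1 - (chi d p)%:~R) * (npow s p - npow t p)); last by ring.
  have := chi_norm R d p; rewrite ler_norml => /andP[_ c2].
  by rewrite mulr_ge0 ?subr_ge0 // ltW // xy.
have Ls := Lchi_gt0 d s1; have Lt := Lchi_gt0 d t1.
have zs := lt_le_trans ltr01 (zeta_ge1 s1); have zt := lt_le_trans ltr01 (zeta_ge1 t1).
set U := zeta s * Lchi d t; set V := zeta t * Lchi d s.
have U0 : 0 < U by rewrite mulr_gt0.
have V0 : 0 < V by rewrite mulr_gt0.
have lim u v : 1 < u -> 1 < v ->
    (E u P * zeta u * (F v P * Lchi d v) @[P --> \oo] --> (1 : R))%classic.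
  move=> u1 v1; rewrite -[X in (_ --> X)%classic]mulr1.
  by apply: cvgM; [exact: zeta_euler|exact: Lchi_euler].
have limA : (E s P * zeta s * (F t P * Lchi d t) * V @[P --> \oo] --> 1 * V)%classic.
  by apply: cvgM; [exact: lim|exact: cvg_cst].
have limB : (E t P * zeta t * (F s P * Lchi d s) * (k * U)
    @[P --> \oo] --> 1 * (k * U))%classic.
  by apply: cvgM; [exact: lim|exact: cvg_cst].
have : V <= k * U.
  rewrite -[leLHS]mul1r -[leRHS]mul1r -(cvg_lim _ limA) // -[leRHS](cvg_lim _ limB) //.
  apply: ler_lim; [exact: cvgP limA|exact: cvgP limB|].
  exists q.+1 => // P /= qltP.
  have UV0 : 0 <= U * V by rewrite mulr_ge0 // ltW.
  have := ler_wpM2r UV0 (le P qltP); congr (_ <= _); rewrite /U /V; ring.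
by move=> /le_lt_trans; apply; rewrite gtr_pMl.
Qed.

(** N >= 0 means zeta / L >= sqrt d, and zeta / L is strictly larger further left. *)
Lemma Nfun_gt0 (R : realType) d (s t : R) : (1 < d)%N -> 1 < s -> s < t ->
  0 <= Nfun d t -> 0 < Nfun d s.
Proof.
move=> d1 s1 st; have t1 := lt_trans s1 st.
have Ls := Lchi_gt0 d s1; have Lt := Lchi_gt0 d t1.
have zt := lt_le_trans ltr01 (zeta_ge1 t1); have zs := lt_le_trans ltr01 (zeta_ge1 s1).
rewrite /Nfun !subr_ge0 subr_gt0 => h.
have h1 : (zeta t * Lchi d s) ^+ 2 < (zeta s * Lchi d t) ^+ 2.
  by rewrite ltrXn2r ?nnegrE ?mulr_ge0 ?ltW // zeta_Lchi_decreasing.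
rewrite -(ltr_pM2r (exprn_gt0 2 Lt)) -exprMn; apply: le_lt_trans h1.
by rewrite mulrAC exprMn ler_wpM2r ?sqr_ge0.
Qed.

Lemma Nfun_continuous (R : realType) d (s : R) : 1 < s ->
  {for s, continuous (@Nfun R d)}.
Proof.
move=> s1; rewrite /continuous_at.
have cz : (zeta t @[t --> s] --> zeta s)%classic.
  rewrite (_ : @zeta R = dirichlet (fun=> 1)).
    by apply: (dirichlet_continuous (c := fun=> 1) _ s1) => n; rewrite normr1.
  by apply/funext => t; exact: zetaE.
have cL : (Lchi d t @[t --> s] --> Lchi d s)%classic.
  apply: (dirichlet_continuous (c := fun n => (chi d n)%:~R) _ s1) => n.
  exact: chi_norm.
apply: cvgB; first exact: cvgM.
by apply: cvgM; [exact: cvg_cst|exact: cvgM].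
Qed.

Lemma Nfun_gt0_near1 (R : realType) d : (1 < d)%N -> squarefree d ->
  exists2 s : R, 1 < s & 0 < Nfun d s.
Proof.
(* The threshold is d times the bound on L, so zeta > d L; squaring suffices since d^2 >= d. *)
move=> d1 sf; have [s s1 zs] := zeta_unbounded (d%:R * (32 * (9 * d ^ 2)%:R) : R).
exists s => //; rewrite /Nfun subr_gt0.
have L0 := Lchi_gt0 d s1; have Lle := Lchi_le d1 sf s1.
have dR : 1 <= d%:R :> R by rewrite ler1n ltnW.
have h : d%:R * Lchi d s < zeta s.
  by apply: le_lt_trans zs; rewrite ler_wpM2l.
apply: le_lt_trans (_ : (d%:R * Lchi d s) ^+ 2 < _).
  by rewrite exprMn ler_wpM2r ?sqr_ge0 // expr2 ler_peMl.
by rewrite ltrXn2r ?nnegrE ?mulr_ge0 // ltW // (le_lt_trans _ h) // mulr_ge0 // ltW.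
Qed.

(** As 2^-5 = 1/32, zeta(5) <= 16/15 and L >= 1 - 1/15, while 2 * 14^2 = 392 > 256 = 16^2. *)
Lemma Nfun5_lt0 (R : realType) d : (1 < d)%N -> Nfun d (5 : R) < 0.
Proof.
move=> d1; have s1 : 1 < 5 :> R by rewrite ltr1n.
have z1 := zeta_ge1 s1.
have e : npow (5 : R) 2 = 32^-1.
  by rewrite /npow powR_mulrn // -natrX.
have z2 : zeta (5 : R) <= 16 / 15.
  apply: le_trans (zeta_le s1) _; rewrite e.
  by rewrite le_eqVlt; apply/orP; left; apply/eqP; field.
have L1 : 14 / 15 <= Lchi d (5 : R).
  have := @dirichlet_dist1 R (fun n => (chi d n)%:~R) 5 _ _ s1; rewrite -LchiE chi1.
  move=> /(_ erefl (chi_norm R d)); rewrite ler_norml => /andP[h _]; lra.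
rewrite /Nfun subr_lt0.
have d2 : 2 <= d%:R :> R by rewrite (ler_nat R 2).
have h1 : zeta (5 : R) ^+ 2 <= (16 / 15) ^+ 2.
  by rewrite lerXn2r ?nnegrE //; lra.
have h2 : (14 / 15 : R) ^+ 2 <= Lchi d (5 : R) ^+ 2.
  by rewrite lerXn2r ?nnegrE //; lra.
have h3 : 2 * (14 / 15 : R) ^+ 2 <= d%:R * Lchi d (5 : R) ^+ 2.
  by rewrite ler_pM // sqr_ge0.
lra.
Qed.

Unset Implicit Arguments.

Theorem mainTheorem18 (R : realType) (d : nat) (d_gt1 : (1 < d)%N)
    (d_sqf : squarefree d) :
  exists s0 : R,
    [/\ unique (fun s : R => 1 < s /\ Nfun d s = 0) s0,
        forall s : R, 1 < s < s0 -> 0 < Nfun d s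
      & forall s : R, s0 < s -> Nfun d s < 0].
Proof.
have [a a1 Na] := Nfun_gt0_near1 R d_gt1 d_sqf.
have Nb := Nfun5_lt0 R d_gt1; have b1 : 1 < 5 :> R by rewrite ltr1n.
(* Positivity propagates to the left, so a >= 5 would contradict N(5) < 0. *)
have ab : a < 5.
  rewrite ltNge le_eqVlt; apply/negP => /orP[/eqP e|ba].
    by move: Na; rewrite -e ltNge ltW.
  by have := Nfun_gt0 d_gt1 b1 ba (ltW Na); rewrite ltNge ltW.
have [|||s0] := @IVT R (@Nfun R d) a 5 0; first exact: ltW.
- apply: continuous_in_subspaceT => x; rewrite inE /= in_itv /= => /andP[ax _].
  by apply: Nfun_continuous => //; exact: lt_le_trans ax.
- by rewrite ge_min le_max (ltW Na) (ltW Nb) orbT.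
rewrite in_itv /= => /andP[as0 _] N0; have s01 := lt_le_trans a1 as0.
have pos s : 1 < s < s0 -> 0 < Nfun d s.
  by move=> /andP[s1 ss0]; apply: Nfun_gt0 ss0 _; rewrite ?N0.
have neg s : s0 < s -> Nfun d s < 0.
  move=> s0s; rewrite ltNge; apply/negP => /(Nfun_gt0 d_gt1 s01 s0s).
  by rewrite N0 ltxx.
exists s0; split=> //; split=> // s [s1 Ns].
have [lt|gt|//] := ltgtP s0 s.
  by have := neg s lt; rewrite Ns ltxx.
by have := pos s; rewrite s1 gt Ns ltxx => /(_ isT).
Qed.
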